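(* The semigroup $Q$ given by the semigroup presentation $$Q = \langle a,b,c,e,x \mid xb = cx,\ ac = ca,\ ae=ea,\ ec=ce,\ xca = xe,\ aex = ax\rangle$$ is not locally embeddable into the class of finite $\mathcal{J}$-trivial semigroups.
   Context: Maps are written on the right. For a semigroup $S$, $S^1$ denotes $S$ if $S$ has an identity and $S$ with an external identity adjoined otherwise. Elements $x,y\in S$ are $\mathcal{J}$-related if $S^1xS^1 = S^1yS^1$. $S$ is $\mathcal{J}$-trivial if any two $\mathcal{J}$-related elements are equal. A semigroup $S$ is locally embeddable into the class of finite $\mathcal{J}$-trivial semigroups if for every finite subset $H$ of $S$ there exist a finite $\mathcal{J}$-trivial semigroup $F_H$ and an injective function $f_H: H\to F_H$ such that for all $x,y\in H$ with $xy\in H$ we have $(xy)f_H=(xf_H)(yf_H)$. The presentation is a semigroup presentation: $Q$ is the quotient of the free semigroup (nonempty words) on the generators by the congruence generated by the relations; the generator $e$ is not assumed to be idempotent or an identity. *)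

(* Defs.v *)
From HB Require Import structures.
From mathcomp Require Import all_boot finmap.
From mathcomp Require Import boolp classical_sets.

Set Implicit Arguments.
Unset Strict Implicit.
Unset Printing Implicit Defensive.

Local Open Scope classical_set_scope.
Local Open Scope quotient_scope.
Local Open Scope group_scope.

#[short(type="finSemigroupType")]
HB.structure Definition FinSemigroup := {F of Semigroup F & Finite F}.

(* [adjoin1 S] always adjoins a new identity [None], even when [S] already has
   one; the monoid written S^1 is the submonoid [S1] of it. *)
Definition adjoin1 (S : semigroupType) : Type := option S.

Section Adjoin1.
Variable S : semigroupType.

Definition adjoin1_mul (u v : adjoin1 S) : adjoin1 S :=
  match u, v with
  | None, _ => v
  | _, None => u
  | Some s, Some t => Some (s * t)
  end.

HB.instance Definition _ := Choice.copy (adjoin1 S) (option S).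

Lemma adjoin1_mulA : associative adjoin1_mul.
Proof. by move=> [s|] [t|] [r|] //=; rewrite mulgA. Qed.

HB.instance Definition _ := isSemigroup.Build (adjoin1 S) adjoin1_mulA.

Definition to_adjoin1 (s : S) : adjoin1 S := Some s.

Definition has_identity : Prop :=
  exists i : S, left_id i (@mul S) /\ right_id i (@mul S).

Definition S1 : set (adjoin1 S) :=
  if `[< has_identity >] then range to_adjoin1 else setT.

Definition principal_ideal (s : S) : set (adjoin1 S) :=
  [set w | exists u v, [/\ S1 u, S1 v & w = u * to_adjoin1 s * v]].

Definition J_related (s t : S) : Prop :=
  principal_ideal s = principal_ideal t.

Definition J_trivial : Prop := forall s t : S, J_related s t -> s = t.

End Adjoin1.

Definition locally_embeddable (K : finSemigroupType -> Prop)
    (S : semigroupType) : Prop :=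
  forall H : {fset S}, exists (F : finSemigroupType) (f : H -> F),
    [/\ K F, injective f &
        forall x y z : H, val z = val x * val y -> f z = f x * f y].

Definition freeSemigroup (X : choiceType) : Type := {w : seq X | w != [::]}.

Section FreeSemigroup.
Variable X : choiceType.

HB.instance Definition _ :=
  Choice.copy (freeSemigroup X) {w : seq X | w != [::]}.

Lemma cat_neq_nil (u v : freeSemigroup X) : val u ++ val v != [::].
Proof. by case: u v => [[|y u] // ?] [v ?]. Qed.

Definition free_mul (u v : freeSemigroup X) : freeSemigroup X :=
  exist _ (val u ++ val v) (cat_neq_nil u v).

Lemma free_mulA : associative free_mul.
Proof. by move=> u v w; apply: val_inj; rewrite /= catA. Qed.

HB.instance Definition _ := isSemigroup.Build (freeSemigroup X) free_mulA.

Definition letter (y : X) : freeSemigroup X := exist _ [:: y] isT.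

End FreeSemigroup.

Section Presentation.
Variables (X : choiceType) (R : set (freeSemigroup X * freeSemigroup X)).

Inductive congruence_gen : freeSemigroup X -> freeSemigroup X -> Prop :=
  | Cong_rel u v : R (u, v) -> congruence_gen u v
  | Cong_refl u : congruence_gen u u
  | Cong_sym u v : congruence_gen u v -> congruence_gen v u
  | Cong_trans u v w :
      congruence_gen u v -> congruence_gen v w -> congruence_gen u w
  | Cong_mul u v u' v' : congruence_gen u v -> congruence_gen u' v' ->
      congruence_gen (u * u') (v * v').

Definition cong_rel : rel (freeSemigroup X) :=
  fun u v => `[< congruence_gen u v >].

Lemma cong_rel_refl : reflexive cong_rel.
Proof. by move=> u; apply/asboolP/Cong_refl. Qed.

Lemma cong_rel_sym : symmetric cong_rel.
Proof. by move=> u v; apply/asboolP/asboolP; apply: Cong_sym. Qed.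

Lemma cong_rel_trans : transitive cong_rel.
Proof.
by move=> v u w /asboolP uv /asboolP vw; apply/asboolP/(Cong_trans uv vw).
Qed.

Canonical cong_equiv : equiv_rel (freeSemigroup X) :=
  EquivRel cong_rel cong_rel_refl cong_rel_sym cong_rel_trans.

Definition presented : Type := {eq_quot cong_equiv}.

HB.instance Definition _ := Choice.copy presented {eq_quot cong_equiv}.
HB.instance Definition _ := EqQuotient.copy presented {eq_quot cong_equiv}.

Lemma presentedP (u v : freeSemigroup X) :
  \pi_presented u = \pi_presented v <-> congruence_gen u v.
Proof. by split=> [/eqmodP/asboolP//|uv]; apply/eqmodP/asboolP. Qed.

Definition presented_mul (p q : presented) : presented :=
  \pi_presented (repr p * repr q).

Lemma presented_mulE (u v : freeSemigroup X) :
  presented_mul (\pi_presented u) (\pi_presented v) = \pi_presented (u * v).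
Proof. by apply/presentedP/Cong_mul; apply/presentedP; rewrite reprK. Qed.

Lemma presented_mulA : associative presented_mul.
Proof.
elim/quotW=> u; elim/quotW=> v; elim/quotW=> w.
by rewrite (presented_mulE u v) (presented_mulE v w) !presented_mulE mulgA.
Qed.

HB.instance Definition _ := isSemigroup.Build presented presented_mulA.

End Presentation.

Variant Qgen : Type := Ga | Gb | Gc | Ge | Gx.

Definition Qgen_encode (g : Qgen) : nat :=
  match g with Ga => 0 | Gb => 1 | Gc => 2 | Ge => 3 | Gx => 4 end.

Definition Qgen_decode (n : nat) : Qgen :=
  match n with 0 => Ga | 1 => Gb | 2 => Gc | 3 => Ge | _ => Gx end.

Lemma Qgen_encodeK : cancel Qgen_encode Qgen_decode.
Proof. by case. Qed.

HB.instance Definition _ := Choice.copy Qgen (can_type Qgen_encodeK).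

Definition Q_relations : set (freeSemigroup Qgen * freeSemigroup Qgen) :=
  let a := letter Ga in
  let b := letter Gb in
  let c := letter Gc in
  let e := letter Ge in
  let x := letter Gx in
  [set` [:: (x * b, c * x); (a * c, c * a); (a * e, e * a); (e * c, c * e);
            (x * c * a, x * e); (a * e * x, a * x)]].

Definition Q : semigroupType := presented Q_relations.

(* Main.v *)
Require Import Defs.
From mathcomp Require Import all_boot.
From mathcomp Require Import finmap boolp classical_sets.

(** Put [P k = x a^(k+1) x].  The relations give [P k = P k.+1 b] for all [k],
    so in a finite semigroup two of the [P k] coincide, everything between them
    is R-equivalent, and J-triviality forces [P 0 b = P 0], that is
    [x e x = x a x].  Only finitely many relations are used, so this holds in
    every finite J-trivial semigroup into which a suitable finite part of [Q]
    embeds.  But [x e x] and [x a x] differ in [Q]: all six relations preserve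
    the parity of the number of letters among [a], [b], [c]. *)

Set Implicit Arguments.
Unset Strict Implicit.
Unset Printing Implicit Defensive.

Local Open Scope quotient_scope.
Local Open Scope group_scope.

Lemma S1_to_adjoin1 (S : semigroupType) (s : S) : S1 (to_adjoin1 s).
Proof. by rewrite /S1; case: ifP => // _; exists s. Qed.

(** If [S] has an identity, [S1] omits [None], so multipliers must be checked; a product with a
    factor from [S] is never [None]. *)
Lemma S1_to_adjoin1_mul (S : semigroupType) (s : S) (v : adjoin1 S) :
  S1 (to_adjoin1 s * v).
Proof.
case: v => [t|]; last exact: S1_to_adjoin1.
exact: (S1_to_adjoin1 (s * t)).
Qed.

Lemma principal_ideal_mulr (S : semigroupType) (s t : S) :
  (principal_ideal (s * t) `<=` principal_ideal s)%classic.
Proof.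
move=> _ [u [v [Su Sv ->]]]; exists u, (to_adjoin1 t * v).
split=> //; first exact: S1_to_adjoin1_mul.
by rewrite (mulgA (u * _)) -(mulgA u (to_adjoin1 s)).
Qed.

Lemma J_related_mulr (S : semigroupType) (s t u v : S) :
  s = t * u -> t = s * v -> J_related s t.
Proof.
move=> st ts; apply/seteqP; split.
  by rewrite st; apply: principal_ideal_mulr.
by rewrite ts; apply: principal_ideal_mulr.
Qed.

Lemma finite_seq_collision (F : finType) (P : nat -> F) :
  exists i j, i < j /\ P i = P j.
Proof.
have /injectivePn[i [j neq_ij Pij]] :
    ~~ injectiveb (fun k : 'I_#|F|.+1 => P k).
  by apply/injectiveP => /leq_card; rewrite card_ord ltnn.
have [lt_ij|lt_ji|/val_inj eq_ij] := ltngtP i j.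
- by exists i, j.
- by exists j, i.
- by rewrite eq_ij eqxx in neq_ij.
Qed.

Lemma J_trivial_descent (F : finSemigroupType) (P : nat -> F) (b : F) :
  J_trivial F -> (forall k, P k = P k.+1 * b) -> P 0 * b = P 0.
Proof.
move=> trivF Pb.
have mulP i k : exists u, P i = P (i + k).+1 * u.
  elim: k => [|k [u Pi]]; first by exists b; rewrite addn0.
  by exists (b * u); rewrite Pi addnS mulgA -Pb.
have [i [j [lt_ij Pij]]] := finite_seq_collision P.
have PiS : P i = P i.+1.
  move: lt_ij; rewrite leq_eqVlt => /predU1P[->//|lt_ij].
  (* Here [i + 2 <= j], so [P i.+1] is a right multiple of [P j = P i], and [P i] is one of
     [P i.+1]. *)
  have [u] := mulP i.+1 (j - i.+2); rewrite -addSn subnKC // -Pij => PSi.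
  exact/trivF/(J_related_mulr (Pb i) PSi).
have Pib : P i * b = P i by rewrite {1}PiS -Pb.
(* Descent: if [b] fixes [P i.+1], then [P i = P i.+1 * b = P i.+1], so [b] fixes [P i] too. *)
suff -> : P 0 = P i by [].
elim: i Pib {mulP lt_ij Pij PiS} => // i IHi Pib.
have PiE : P i = P i.+1 by rewrite Pb Pib.
by rewrite -PiE; apply: IHi; rewrite PiE.
Qed.

Lemma J_trivial_collapse (F : finSemigroupType) (a b c e x : F) :
  J_trivial F -> x * b = c * x -> a * c = c * a -> a * e = e * a ->
  x * c * a = x * e -> a * e * x = a * x -> x * a * x = x * e * x.
Proof.
move=> trivF xb ac ae xca aex.
pose y k := iter k (mul a) (a * x).
have yb k : y k * b = c * y k.
  elim: k => [|k IHk] /=; first by rewrite -mulgA xb !mulgA ac.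
  by rewrite -mulgA IHk !mulgA ac.
have ey k : e * y k = y k.
  elim: k => [|k IHk] /=; first by rewrite mulgA -ae aex.
  by rewrite mulgA -ae -mulgA IHk.
(* With [y k] standing for [a^(k+1) x]: [x y_k = x e y_k = x c a y_k = x c y_(k+1) = x y_(k+1)
   b]. *)
have Pb k : x * y k = x * y k.+1 * b.
  by rewrite -mulgA yb /= -/(y k) !mulgA xca -mulgA ey.
have := J_trivial_descent (P := fun k => x * y k) trivF Pb.
by rewrite -mulgA yb /= !mulgA xca => <-.
Qed.

(** Replaces the map on a finite subtype by a total one, so that products need no membership proofs;
    [s0] supplies the default argument off the list. *)
Lemma locally_embeddable_in (K : finSemigroupType -> Prop) (S : semigroupType)
    (s0 : S) (s : seq S) :
  locally_embeddable K S ->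
  exists (F : finSemigroupType) (g : S -> F),
    [/\ K F, {in s0 :: s &, injective g} &
        {in s0 :: s &, forall p q,
           p * q \in s0 :: s -> g (p * q) = g p * g q}].
Proof.
pose H : {fset S} := [fset p in s0 :: s]%fset.
have inH p : p \in s0 :: s -> p \in H by rewrite in_fset.
move=> /(_ H)[F [f [KF f_inj fM]]].
pose h0 : H := FSetSub (inH s0 (mem_head s0 s)).
exists F, (fun p => f (insubd h0 p)); split=> // [p q ps qs|p q ps qs pqs].
  by move=> /f_inj/(congr1 val); rewrite !insubdK ?inH.
by apply: fM; rewrite !insubdK ?inH.
Qed.

Lemma not_locally_embeddable_J_trivial (S : semigroupType) (a b c e x : S) :
  x * b = c * x -> a * c = c * a -> a * e = e * a ->
  x * c * a = x * e -> a * e * x = a * x -> x * a * x <> x * e * x ->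
  ~ locally_embeddable (fun F : finSemigroupType => J_trivial F) S.
Proof.
move=> xb ac ae xca aex neq.
(* Together with [a], these are the values of all left-bracketed subproducts in the five relations
   used and in [x a x], [x e x]. *)
pose s := [:: b; c; e; x; x * b; a * c; a * e; x * c; x * e; a * x; x * a;
              x * a * x; x * e * x].
move=> /(locally_embeddable_in a s)[F [g [trivF g_inj gM]]].
have gME p q : p \in a :: s -> q \in a :: s -> p * q \in a :: s ->
  g p * g q = g (p * q) by move=> ps qs pqs; rewrite gM.
have := @J_trivial_collapse F (g a) (g b) (g c) (g e) (g x) trivF.
rewrite !gME -?xb -?ac -?ae ?xca ?aex ?inE ?eqxx ?orbT //.
move=> /(_ erefl erefl erefl erefl erefl)/g_inj eq_xax.
by apply/neq/eq_xax; rewrite !inE eqxx ?orbT.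
Qed.

Definition abc_parity (w : freeSemigroup Qgen) : bool :=
  odd (count (fun g => if g is (Ga | Gb | Gc) then true else false) (val w)).

(** The relation [xca = xe] changes the count by two; the other five preserve it. *)
Lemma abc_parity_cong (u v : freeSemigroup Qgen) :
  congruence_gen Q_relations u v -> abc_parity u = abc_parity v.
Proof.
elim=> {u v} [u v|//|u v _ ->//|u v w _ -> _ ->//|u v u' v' _ uv _ uv'].
  by rewrite /Q_relations /= !inE => /or4P[| | |/or3P[]] /eqP[-> ->].
by move: uv uv'; rewrite /abc_parity /= !count_cat !oddD => -> ->.
Qed.

Definition Qgen_elt (g : Qgen) : Q := \pi_(presented Q_relations) (letter g).

Lemma Q_mulE (u v : freeSemigroup Qgen) :
  (\pi_(presented Q_relations) u : Q) * \pi_(presented Q_relations) v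
  = \pi_(presented Q_relations) (u * v).
Proof. exact: presented_mulE. Qed.

Lemma Q_rel (u v : freeSemigroup Qgen) :
  Q_relations (u, v) ->
  \pi_(presented Q_relations) u = \pi_(presented Q_relations) v.
Proof. by move=> uv; apply/presentedP/Cong_rel. Qed.

Theorem proposition10 :
  ~ locally_embeddable (fun F : finSemigroupType => J_trivial F) Q.
Proof.
pose a := Qgen_elt Ga; pose b := Qgen_elt Gb; pose c := Qgen_elt Gc.
pose e := Qgen_elt Ge; pose x := Qgen_elt Gx.
have xb : x * b = c * x.
  rewrite !Q_mulE; apply: Q_rel.
  by rewrite /Q_relations /= !inE eqxx.
have ac : a * c = c * a.
  rewrite !Q_mulE; apply: Q_rel.
  by rewrite /Q_relations /= !inE eqxx ?orbT.
have ae : a * e = e * a.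
  rewrite !Q_mulE; apply: Q_rel.
  by rewrite /Q_relations /= !inE eqxx ?orbT.
have xca : x * c * a = x * e.
  (* Without explicit arguments, [Q_mulE] would unfold [x * c] to its [repr]s. *)
  rewrite (Q_mulE (letter Gx) (letter Gc)) !Q_mulE; apply: Q_rel.
  by rewrite /Q_relations /= !inE eqxx ?orbT.
have aex : a * e * x = a * x.
  rewrite (Q_mulE (letter Ga) (letter Ge)) !Q_mulE; apply: Q_rel.
  by rewrite /Q_relations /= !inE eqxx ?orbT.
have neq : x * a * x <> x * e * x.
  (* The count is 1 for [x a x] and 0 for [x e x]. *)
  by rewrite !(Q_mulE (letter Gx)) !Q_mulE => /presentedP/abc_parity_cong.
exact: not_locally_embeddable_J_trivial xb ac ae xca aex neq.
Qed.
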